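(* Let $I\subset\mathbb{R}$ be a bounded open interval, let $\varphi\in C_c^\infty(\mathbb{R};\mathbb{R})$ be nonzero, and choose $d_1<d_2<d_3<d_4$ such that $\operatorname{supp}\varphi+d_k$ is compactly contained in $I$ for $k=1,2,3,4$. Set $\psi_k(t):=\varphi(t-d_k)$, $k=1,2,3,4$. Then the four-profile family $(\psi_1,\psi_2,\psi_3,\psi_4)$ is Hermite--Laplace nondegenerate. Moreover, every one- or two-profile subfamily is two-sided Laplace nondegenerate, and every subfamily of at most four profiles is Hermite--Laplace nondegenerate.
   Context: For $\psi\in C_c^\infty(I)$ let $\mathscr L_\psi(z)=\int_I\psi(t)e^{zt}\,dt$ and $\mathscr L_\psi'(z)=\int_It\psi(t)e^{zt}\,dt$, $z\in\mathbb{C}$. For $\Psi=(\psi_1,\dots,\psi_N)$ in $(C_c^\infty(I;\mathbb{R}))^N$, let $\mathscr V_\Psi(z)$ be the $2\times N$ matrix whose $k$-th column is $(\mathscr L_{\psi_k}(z),\mathscr L_{\psi_k}(-z))^\top$, and $\mathscr H_\Psi(z)$ the $4\times N$ matrix whose $k$-th column is $(\mathscr L_{\psi_k}(z),\mathscr L'_{\psi_k}(z),\mathscr L_{\psi_k}(-z),\mathscr L'_{\psi_k}(-z))^\top$, where $\mathscr L'_\psi(-z)$ is the derivative evaluated at $-z$. For $1\le N\le2$, $\Psi$ is two-sided Laplace nondegenerate if some $N\times N$ minor of $\mathscr V_\Psi$ is not identically zero in $z$. For $1\le N\le4$, $\Psi$ is Hermite--Laplace nondegenerate if some $N\times N$ minor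 of $\mathscr H_\Psi$ is not identically zero in $z$. Subfamilies are nonempty. *)

(* Defs.v *)
From mathcomp Require Import all_boot all_order all_algebra.
From mathcomp Require Import all_classical all_reals all_analysis.
From mathcomp Require Import complex.
Import Order.TTheory GRing.Theory Num.Theory.
Import numFieldNormedType.Exports.

Set Implicit Arguments.
Unset Strict Implicit.
Unset Printing Implicit Defensive.

Local Open Scope classical_set_scope.
Local Open Scope ring_scope.
Local Open Scope complex_scope.

Definition supp (R : realType) (f : R -> R) : set R :=
  closure [set t | f t != 0].

Definition smooth (R : realType) (f : R -> R) : Prop :=
  forall (n : nat) (t : R), derivable (derive1n n f) t 1.

(* The space C_c^oo(I; R); functions on an open set I are represented by
   their extensions by zero to the whole line. *)
Definition Cc_smooth (R : realType) (I : set R) : set (R -> R) :=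
  [set f | [/\ smooth f, compact (supp f) & supp f `<=` I]].

Definition compactly_contained (R : realType) (A B : set R) : Prop :=
  compact (closure A) /\ closure A `<=` B.

Definition cexp (R : realType) (z : R[i]) : R[i] :=
  (expR (complex.Re z))%:C * (cos (complex.Im z) +i* sin (complex.Im z)).

(* Integral of a complex-valued function with respect to Lebesgue measure.
   As with Rintegral, the value is meaningful only when the real and imaginary
   parts are integrable, which is the case for the continuous compactly
   supported integrands below. *)
Definition cintegral (R : realType) (I : set R) (f : R -> R[i]) : R[i] :=
  Rintegral lebesgue_measure I (fun t => complex.Re (f t))
  +i* Rintegral lebesgue_measure I (fun t => complex.Im (f t)).

Definition laplace (R : realType) (I : set R) (psi : R -> R) (z : R[i]) : R[i] :=
  cintegral I (fun t => (psi t)%:C * cexp (z * t%:C)).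

Definition laplace' (R : realType) (I : set R) (psi : R -> R) (z : R[i]) : R[i] :=
  cintegral I (fun t => (t * psi t)%:C * cexp (z * t%:C)).

Definition two_sided_matrix (R : realType) (I : set R) (N : nat)
    (Psi : 'I_N -> R -> R) (z : R[i]) : 'M[R[i]]_(2, N) :=
  \matrix_(i < 2, k < N)
    [:: laplace I (Psi k) z; laplace I (Psi k) (- z)]`_i.

Definition hermite_matrix (R : realType) (I : set R) (N : nat)
    (Psi : 'I_N -> R -> R) (z : R[i]) : 'M[R[i]]_(4, N) :=
  \matrix_(i < 4, k < N)
    [:: laplace I (Psi k) z; laplace' I (Psi k) z;
        laplace I (Psi k) (- z); laplace' I (Psi k) (- z)]`_i.

(* An N x N minor of an m x N matrix is given by a strictly increasing choice
   r of N of the m rows; the choice does not depend on z. *)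
Definition some_minor_not_identically_zero (R : realType) (m N : nat)
    (M : R[i] -> 'M[R[i]]_(m, N)) : Prop :=
  exists2 r : 'I_N -> 'I_m, {homo r : i j / (i < j)%N} &
    exists z : R[i], \det (rowsub r (M z)) != 0.

Definition two_sided_laplace_nondegenerate (R : realType) (I : set R) (N : nat)
    (Psi : 'I_N -> R -> R) : Prop :=
  [/\ (1 <= N <= 2)%N, forall k, Cc_smooth I (Psi k) &
      some_minor_not_identically_zero (two_sided_matrix I Psi)].

Definition hermite_laplace_nondegenerate (R : realType) (I : set R) (N : nat)
    (Psi : 'I_N -> R -> R) : Prop :=
  [/\ (1 <= N <= 4)%N, forall k, Cc_smooth I (Psi k) &
      some_minor_not_identically_zero (hermite_matrix I Psi)].

(* Main.v *)
(* For real z = x one has L_{psi_k}(x) = e^{x d_k} Phi(x) and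
   L'_{psi_k}(x) = e^{x d_k} (Phi'(x) + d_k Phi(x)), Phi being the Laplace
   transform of phi.  If m_n is the first nonzero moment of phi then
   Phi(x) = m_n x^n / n! + O(x^{n+1}), so Phi(x) and Phi(-x) are both nonzero
   for some small x > 0; not all moments vanish, since polynomials can be
   concentrated near a point where phi is nonzero.  For such x, a linear
   relation between the rows of the Hermite matrix is a function
   (A + B t) e^{xt} + (C + D t) e^{-xt} vanishing at d_1, ..., d_4, which is
   zero by Rolle's theorem.  Hence the 4 x 4 matrix is invertible, and any N of
   its columns have a nonzero N x N minor. *)
Require Import Defs.
From mathcomp Require Import all_boot all_order all_algebra.
From mathcomp Require Import all_classical all_reals all_analysis.
From mathcomp Require Import complex.
From mathcomp Require Import ring lra.
Import Order.TTheory GRing.Theory Num.Theory.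
Import numFieldNormedType.Exports.

Local Open Scope classical_set_scope.
Local Open Scope ring_scope.

(** * Integrals of continuous functions with bounded support *)

Lemma integrable_bounded_support (R : realType) (A : R) (f : R -> R) :
  continuous f -> (forall t, A < `|t| -> f t = 0) ->
  (@lebesgue_measure R).-integrable setT (EFin \o f).
Proof.
move=> cf f0.
have -> : EFin \o f = (EFin \o f) \_ (`[- A, A] : set R).
  apply/funext => t; rewrite patchE; case: ifPn => // /negP tA /=.
  rewrite f0// ltNge; apply/negP => tA'; apply: tA.
  by rewrite inE/= in_itv/= -ler_norml.
apply/(integrable_mkcond _ _).1; first exact: measurable_itv.
apply: continuous_compact_integrable; first exact: segment_compact.
exact: continuous_subspaceT.
Qed.

Lemma Rintegral_shift (R : realType) (a b d : R) (f : R -> R) :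
  a <= b -> continuous f -> (forall t, ~ `]a, b[%classic t -> f t = 0) ->
  \int[lebesgue_measure]_(t in `]a, b[) f t =
  \int[lebesgue_measure]_t f (t + d).
Proof.
move=> ab cf f0.
(* Since [f] vanishes at both endpoints, the interval may be closed, the form in which the
   substitution [t + d] applies. *)
have -> : \int[lebesgue_measure]_(t in `]a, b[) f t =
          \int[lebesgue_measure]_(t in `[a, b]) f t.
  rewrite Rintegral_mkcond [RHS]Rintegral_mkcond; apply: eq_Rintegral => t _.
  rewrite !patchE !mem_setE; case: ifPn => [tab|/negP tab].
    by rewrite (subset_itv_oo_cc tab).
  by rewrite f0//; case: ifP.
pose F (t : R) := t + d.
have dF (x : R) : is_derive x 1 F 1 by exact: is_derive_shift.
have dF1 : derive1 F = cst 1.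
  by apply/funext => x; rewrite derive1E derive_val.
have cF : continuous F.
  by move=> x; apply: differentiable_continuous; apply/derivable1_diffP.
have -> : \int[lebesgue_measure]_(t in `[a, b]) f t =
          \int[lebesgue_measure]_(t in `[a - d, b - d]) f (t + d).
  rewrite /Rintegral -[in LHS](subrK d a) -[in LHS](subrK d b).
  rewrite -[a - d + d]/(F _) -[b - d + d]/(F _).
  rewrite (@integration_by_substitution_increasing _ F).
  - by rewrite dF1; congr fine; apply: eq_integral => x _;
    rewrite /= !fctE mulr1.
  - by rewrite lerB.
  - by move=> x y _ _ xy; rewrite /= ltrD2r.
  - by move=> x _; rewrite dF1; exact: cst_continuous.
  - by rewrite dF1; exact: is_cvg_cst.
  - by rewrite dF1; exact: is_cvg_cst.
  - split; first by move=> x _; exact: ex_derive.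
    + exact/cvg_at_right_filter/cF.
    + exact/cvg_at_left_filter/cF.
  - exact: continuous_subspaceT.
rewrite Rintegral_mkcond; apply: eq_Rintegral => t _.
rewrite patchE; case: ifPn => // /negP tab; rewrite f0// => tab'; apply: tab.
by move: tab'; rewrite inE/= !in_itv/=; lra.
Qed.

(** * Zeros of exponential polynomials *)

Lemma is_derive_affine_expR (R : realType) (A B c t : R) :
  is_derive t 1 (fun t => (A + B * t) * expR (c * t))
    ((B + c * A + c * B * t) * expR (c * t)).
Proof.
have dc : is_derive t 1 (fun t => c * t) c.
  apply: is_derive_eq.
  by rewrite /GRing.scale/= ?(mulr0, mulr1, mul0r, add0r, addr0).
have de : is_derive t 1 (fun t => expR (c * t)) (expR (c * t) * c).
  exact: (is_derive1_comp (f := expR)).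
apply: is_derive_eq; rewrite /GRing.scale/=; ring.
Qed.

Lemma affine_eq0 (R : idomainType) (A B s t : R) :
  s != t -> A + B * s = 0 -> A + B * t = 0 -> A = 0 /\ B = 0.
Proof.
move=> st As At; have /eqP : B * (s - t) = 0.
  by rewrite mulrBr -[B * s](addKr A) As addr0 -[B * t](addKr A) At addr0 subrr.
rewrite mulf_eq0 subr_eq0 (negbTE st) orbF => /eqP B0.
by move: As; rewrite B0 mul0r addr0.
Qed.

Lemma Rolle_eq0 (R : realType) (f df : R -> R) (s t : R) : s < t ->
  (forall x : R, is_derive x 1 f (df x)) -> f s = 0 -> f t = 0 ->
  exists2 c, s < c < t & df c = 0.
Proof.
move=> st fdf fs ft; have [] := @Rolle R f s t st.
- by move=> x _; exact: ex_derive.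
- by apply: derivable_within_continuous => x _; exact: ex_derive.
- by rewrite fs ft.
- move=> c cst fc0; exists c; first by move: cst; rewrite in_itv.
  by have [_ <-] := fdf c; have [_ ->] := fc0.
Qed.

(* After multiplication by e^{xt}, differentiating twice kills C + D t and
   leaves an affine function times e^{2xt} with two zeros. *)
Lemma exp_polynomial_eq0 (R : realType) (x A B C D : R) (t : 'I_4 -> R) :
  x != 0 -> {homo t : i j / (i < j)%N >-> (i < j)%R} ->
  (forall k, (A + B * t k) * expR (x * t k) +
             (C + D * t k) * expR (- x * t k) = 0) ->
  [/\ A = 0, B = 0, C = 0 & D = 0].
Proof.
move=> x0 incr zero.
pose h (A B c t : R) := (A + B * t) * expR (c * t).
have dh (A' B' c s : R) : is_derive s 1 (h A' B' c) (h (B' + c * A') (c * B') c s).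
  exact: is_derive_affine_expR.
have h0 A' B' s : h A' B' 0 s = A' + B' * s by rewrite /h mul0r expR0 mulr1.
have [y yE] : exists y, y = 2 * x by exists (2 * x).
have y0 : y != 0 by rewrite yE mulf_neq0// pnatr_eq0.
(* [g] is the given function times e^{xt}, so the rates x and -x become [y] = 2x and 0; [g1] and
   [g2] are its first two derivatives. *)
pose g s := h A B y s + h C D 0 s.
pose g1 s := h (B + y * A) (y * B) y s + h D 0 0 s.
pose g2 s := h (y * B + y * (B + y * A)) (y * (y * B)) y s.
have dg (s : R) : is_derive s 1 g (g1 s).
  by apply: is_derive_eq; rewrite /g1 !mul0r addr0.
have dg1 (s : R) : is_derive s 1 g1 (g2 s).
  by apply: is_derive_eq; rewrite /g2 !mul0r add0r h0 !mul0r !addr0.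
have g0 k : g (t k) = 0.
  rewrite /g h0 /h yE (_ : 2 * x * t k = x * t k + x * t k); last by ring.
  rewrite expRD mulrA -[C + _]mulr1 -[1](expRxMexpNx_1 (x * t k)) -mulNr.
  by rewrite [expR (x * t k) * _]mulrC !mulrA -mulrDl zero mul0r.
(* The four zeros of [g] give three zeros of [g1], kept distinct by [t 1] and [t 2]; these in turn
   give two zeros of [g2], kept distinct by [c2]. *)
have [||//|c1 /andP[_ c1t] z1] := @Rolle_eq0 R g g1 (t 0) (t 1); rewrite ?incr//.
have [||//|c2 /andP[tc2 c2t] z2] := @Rolle_eq0 R g g1 (t 1) (t 2); rewrite ?incr//.
have [||//|c3 /andP[tc3 _] z3] := @Rolle_eq0 R g g1 (t 2) (t 3); rewrite ?incr//.
have c12 : c1 < c2 by exact: lt_trans tc2.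
have c23 : c2 < c3 by exact: lt_trans tc3.
have [e1 /andP[_ e1c] w1] := Rolle_eq0 _ _ _ _ _ c12 dg1 z1 z2.
have [e2 /andP[ce2 _] w2] := Rolle_eq0 _ _ _ _ _ c23 dg1 z2 z3.
have e12 : e1 != e2 by rewrite lt_eqF// (lt_trans e1c).
have lin s : g2 s = 0 -> (y * B + y * (B + y * A)) + (y * (y * B)) * s = 0.
  by move=> /eqP; rewrite mulf_eq0 (gt_eqF (expR_gt0 _)) orbF => /eqP.
(* The slope y^2 B yields B = 0; the constant term then reduces to y^2 A and yields A = 0. *)
have [/eqP] := affine_eq0 _ _ _ _ _ e12 (lin _ w1) (lin _ w2).
move=> yA /eqP; rewrite !mulf_eq0 !(negbTE y0)/= => /eqP B0.
move: yA; rewrite B0 mulr0 !add0r !mulf_eq0 !(negbTE y0)/= => /eqP A0.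
have lin' k : C + D * t k = 0.
  by rewrite -(g0 k) /g h0 /h A0 B0 mul0r addr0 mul0r add0r.
have t01 : t 0 != t 1 by rewrite lt_eqF// incr.
by have [-> ->] := affine_eq0 _ _ _ _ _ t01 (lin' 0) (lin' 1).
Qed.

(** Each Taylor remainder is a primitive of the preceding one and vanishes at 0, so the mean value
    theorem gains one factor |y| per induction step. The factor 1/n! is dropped, as only the order
    in y matters later. *)
Lemma expR_taylor_le (R : realType) (n : nat) (y : R) :
  `|expR y - \sum_(k < n) y ^+ k / k`!%:R| <= `|y| ^+ n * expR `|y|.
Proof.
pose E n (y : R) := expR y - \sum_(k < n) y ^+ k / k`!%:R.
have dE m (z : R) : is_derive z 1 (E m.+1) (E m z).
  elim: m => [|m IH].
    have -> : E 1 = expR - cst 1.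
      by apply/funext => s; rewrite /E big_ord1 expr0 fact0 divr1.
    by rewrite /E big_ord0; apply: is_derive_eq.
  have -> : E m.+2 = E m.+1 - m.+1`!%:R^-1 \*: (id ^+ m.+1).
    apply/funext => s; rewrite [LHS]/E big_ord_recr/= opprD addrA.
    by rewrite [_ * _^-1]mulrC !fctE.
  apply: is_derive_eq. rewrite [in RHS]/E big_ord_recr/= opprD addrA.
  congr (_ - _); rewrite /GRing.scale/= factS natrM invfM -mulr_natr mulr1.
  have : m.+1%:R != 0 :> R by rewrite pnatr_eq0.
  have : m`!%:R != 0 :> R by rewrite pnatr_eq0 -lt0n fact_gt0.
  by move: m`!%:R m.+1%:R => p q p0 q0; field; rewrite p0 q0.
rewrite -/(E n y); elim: n y => [|n IH] y.
  by rewrite /E big_ord0 subr0 expr0 mul1r ger0_norm ?expR_ge0// ler_expR ler_norm.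
have E0 : E n.+1 0 = 0.
  rewrite /E expR0 big_ord_recl expr0 fact0 divr1 big1 ?addr0 ?subrr// => k _.
  by rewrite exprS mul0r mul0r.
(* The mean value point lies between 0 and [y]; the bound increases with the absolute value, so it
   may be taken at [y]. *)
have mono z : `|z| <= `|y| -> `|E n z| <= `|y| ^+ n * expR `|y|.
  move=> zy; apply: le_trans (IH z) _.
  by rewrite ler_pM ?exprn_ge0 ?expR_ge0 ?lerXn2r ?nnegrE ?ler_expR.
have cE (s t : R) : {within `[s, t], continuous E n.+1}.
  by apply: derivable_within_continuous => z _; exact: ex_derive.
have bnd z : `|z| <= `|y| -> `|E n.+1 y| = `|E n z * y| ->
    `|E n.+1 y| <= `|y| ^+ n.+1 * expR `|y|.
  by move=> /mono zy ->; rewrite normrM mulrC exprS -mulrA ler_wpM2l.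
have [y0|y0|<-] := ltgtP 0 y.
- have [z zy] := MVT y0 (fun z _ => dE n z) (cE _ _).
  rewrite E0 !subr0 => eE; apply: (bnd z); last by rewrite eE.
  move: zy; rewrite in_itv/= => /andP[z0 zy].
  by rewrite !ger0_norm// ltW.
- have [z zy] := MVT y0 (fun z _ => dE n z) (cE _ _).
  rewrite E0 !sub0r => eE; apply: (bnd z); last first.
    by rewrite -normrN eE mulrN normrN.
  move: zy; rewrite in_itv/= => /andP[z0 zy].
  by rewrite !ltr0_norm// lerN2 ltW.
- by rewrite E0 normr0 mulr_ge0 ?exprn_ge0 ?expR_ge0.
Qed.

(** * Moments and Laplace transform of a continuous weight with bounded support *)

Section CompactlySupportedWeight.
Context (R : realType) (phi : R -> R) (A : R).
Context (cphi : continuous phi) (phi0 : forall t, A < `|t| -> phi t = 0).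

Local Notation mu := (@lebesgue_measure R).
Local Notation moment n := (\int[mu]_t (phi t * t ^+ n)).

Lemma continuous_weighted (g : R -> R) :
  continuous g -> continuous (fun t => phi t * g t).
Proof. by move=> cg t; apply: cvgM; [exact: cphi|exact: cg]. Qed.

Lemma integrable_weighted (g : R -> R) : continuous g ->
  mu.-integrable setT (EFin \o (fun t => phi t * g t)).
Proof.
move=> cg; apply: (integrable_bounded_support _ A).
  exact: continuous_weighted.
by move=> t tA; rewrite phi0// mul0r.
Qed.

Lemma Rintegral_weightedD (f g : R -> R) : continuous f -> continuous g ->
  \int[mu]_t (phi t * (f t + g t)) =
  \int[mu]_t (phi t * f t) + \int[mu]_t (phi t * g t).
Proof.
move=> cf cg; rewrite -RintegralD//; [|exact: integrable_weighted..].
by apply: eq_Rintegral => t _; rewrite mulrDr.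
Qed.

Lemma Rintegral_weightedZ (r : R) (g : R -> R) : continuous g ->
  \int[mu]_t (phi t * (r * g t)) = r * \int[mu]_t (phi t * g t).
Proof.
move=> cg; rewrite -RintegralZl//; last exact: integrable_weighted.
by apply: eq_Rintegral => t _; rewrite mulrCA.
Qed.

Lemma integrable_normr_weighted (g : R -> R) : continuous g ->
  mu.-integrable setT (EFin \o (fun t => `|phi t| * g t)).
Proof.
move=> cg; apply: (integrable_bounded_support _ A) => [t|t /phi0 ->]; last first.
  by rewrite normr0 mul0r.
apply: cvgM; last exact: cg.
by apply: continuous_comp; [exact: cphi|exact: norm_continuous].
Qed.

Lemma Rintegral_weighted_poly (n : nat) (a : nat -> R) :
  \int[mu]_t (phi t * (\poly_(k < n) a k).[t]) = \sum_(k < n) a k * moment k.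
Proof.
under eq_Rintegral do rewrite horner_poly.
elim: n => [|n IH].
  under eq_Rintegral do rewrite big_ord0 mulr0.
  by rewrite big_ord0 Rintegral_cst// mul0r.
under eq_Rintegral do rewrite big_ord_recr.
rewrite Rintegral_weightedD ?IH.
- by rewrite big_ord_recr/= Rintegral_weightedZ//; exact: exprn_continuous.
- move=> t; rewrite [X in continuous_at t X](_ : _ = horner (\poly_(k < n) a k)).
    exact: continuous_horner.
  by apply/funext => s; rewrite horner_poly.
- by move=> t; apply: cvgM; [exact: cvg_cst|exact: exprn_continuous].
Qed.

(* The polynomials (1 + c delta^2 - c (t - t0)^2)^n concentrate near t0 while
   staying bounded by 1 on the rest of the support. *)
Lemma moments_eq0 : (forall n, moment n = 0) -> forall t, phi t = 0.
Proof.
move=> m0 t0; apply/eqP/negPn/negP => phit0.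
have A0 : `|t0| <= A by rewrite leNgt; apply: contra_neqN phit0; exact: phi0.
have e0 : 0 < `|phi t0| / 2 by rewrite divr_gt0// normr_gt0.
set e := `|phi t0| / 2 in e0; pose sg := Num.sg (phi t0).
(* By continuity [phi] keeps the sign of [phi t0] near [t0], with absolute value above half of
   [|phi t0|]. *)
have [delta delta0 near_t0] : exists2 delta, 0 < delta &
    forall t, `|t - t0| < delta -> e < phi t * sg.
  have /(_ (`]e, +oo[%classic)) : phi t * sg @[t --> t0] --> phi t0 * sg.
    by apply: cvgMl; exact: cphi.
  rewrite [phi t0 * _]mulrC -normrEsg => /(_ _)[|delta /= delta0 sub].
    apply: open_nbhs_nbhs; split; first exact: rray_open.
    by move: e0; rewrite /= in_itv/= andbT /e; lra.
  exists delta => // t tt0; have := sub t; rewrite /= in_itv/= andbT; apply.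
  by rewrite distrC.
have A_gt0 : 0 < A + 1 by rewrite ltr_wpDl// (le_trans _ A0).
(* For |t| <= A one has |t - t0| <= 2(A + 1), so this [c] ensures c (t - t0)^2 <= 1 there; A + 1 is
   positive even when A = 0. *)
pose c := ((2 * (A + 1)) ^+ 2)^-1.
have c0 : 0 < c by rewrite invr_gt0 exprn_gt0// mulr_gt0.
(* 1 + K is the value of [p] at distance delta/2 from [t0], hence its minimum on [J]. *)
pose K := 3 / 4 * (c * delta ^+ 2).
have K0 : 0 < K by rewrite !mulr_gt0 ?divr_gt0 ?exprn_gt0.
pose p : {poly R} := (1 + c * delta ^+ 2)%:P - c *: ('X - t0%:P) ^+ 2.
have pE t : p.[t] = 1 + c * delta ^+ 2 - c * (t - t0) ^+ 2 by rewrite !hornerE.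
pose J := `[t0 - delta / 2, t0 + delta / 2]%classic : set R.
pose I0 := \int[mu]_t `|phi t|.
have intI0 : mu.-integrable setT (EFin \o (fun t => `|phi t|)).
  have := integrable_normr_weighted _ (@cst_continuous R R 1).
  by under [X in EFin \o X]eq_fun do rewrite mulr1.
have intJ : mu.-integrable setT (EFin \o \1_J) by exact: integrable_indic_itv.
have muJ : \int[mu]_t \1_J t = delta.
  rewrite /Rintegral integral_indic ?setIT//; last exact: measurable_itv.
  transitivity (fine (t0 + delta / 2 - (t0 - delta / 2))%:E).
    congr fine; apply: etrans (lebesgue_measure_itv _) _.
    by rewrite /= lte_fin ltrD2l ifT//; lra.
  by rewrite /=; field.
have bern n : 1 + n%:R * K <= (1 + K) ^+ n.
  elim: n => [|n IH]; first by rewrite mul0r addr0 expr0.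
  have n0 : 0 <= n%:R :> R by [].
  by rewrite exprS -natr1; nra.
(* On [J] the Bernoulli inequality [bern] makes the product at least e n K. On the rest of the
   delta-neighbourhood the product is nonnegative. Farther away |p| <= 1 as long as |t| <= A, so it
   is at least -|phi t|; beyond A, [phi] vanishes. *)
have lower n t : e * (n%:R * K) * \1_J t - `|phi t| <= phi t * (sg *: p ^+ n).[t].
  rewrite hornerZ horner_exp [phi t * _]mulrA.
  have [tt0|tt0] := ltP `|t - t0| delta.
    have phit := near_t0 _ tt0.
    have p1 : 1 <= p.[t].
      rewrite pE -addrA lerDl -mulrBr mulr_ge0 ?(ltW c0)// subr_ge0.
      by rewrite -[leLHS]real_normK ?num_real// lerXn2r// ?nnegrE ltW.
    have p1n : 0 <= p.[t] ^+ n by rewrite exprn_ge0// (le_trans _ p1).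
    have absp := normr_ge0 (phi t).
    rewrite indicE; case: (boolP (t \in J)) => [tJ|_]; last first.
      rewrite mulr0 sub0r (@le_trans _ _ 0) ?oppr_le0// mulr_ge0//.
      exact: ltW (lt_trans e0 phit).
    have pK : 1 + K <= p.[t].
      have : (t - t0) ^+ 2 <= (delta / 2) ^+ 2.
        by move: tJ; rewrite inE /J /= in_itv/= => /andP[? ?]; nra.
      by rewrite pE /K; nra.
    have pnK : (1 + K) ^+ n <= p.[t] ^+ n.
      by rewrite lerXn2r// nnegrE; lra.
    rewrite mulr1 (@le_trans _ _ (e * p.[t] ^+ n))//.
      rewrite (@le_trans _ _ (e * (n%:R * K)))//; first by lra.
      by rewrite ler_pM2l// (le_trans _ pnK)// (le_trans _ (bern n))//; lra.
    by rewrite ler_wpM2r// ltW.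
  rewrite indicE memNset ?mulr0 ?sub0r; last first.
    rewrite /J/= in_itv/= => /andP[? ?].
    by move: tt0; rewrite ler_normr => /orP[] ?; lra.
  have [tA|tA] := ltP A `|t|; first by rewrite phi0// normr0 oppr0 !mul0r.
  have p1 : `|p.[t]| <= 1.
    have u1 : delta ^+ 2 <= (t - t0) ^+ 2.
      rewrite -[leRHS]real_normK ?num_real// lerXn2r// ?nnegrE//.
      exact: ltW.
    have u2 : (t - t0) ^+ 2 <= (2 * (A + 1)) ^+ 2.
      rewrite -[leLHS]real_normK ?num_real// lerXn2r// ?nnegrE//.
        by rewrite mulr_ge0// ltW.
      by rewrite (le_trans (ler_normB _ _))//; lra.
    have cu1 : c * delta ^+ 2 <= c * (t - t0) ^+ 2 by rewrite ler_pM2l.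
    have cu2 : c * (t - t0) ^+ 2 <= 1.
      by rewrite mulrC ler_pdivrMr ?mul1r// exprn_gt0// mulr_gt0.
    have cd : 0 < c * delta ^+ 2 by rewrite mulr_gt0// exprn_gt0.
    by rewrite ler_norml pE; apply/andP; split; lra.
  have : `|phi t * sg * p.[t] ^+ n| <= `|phi t|.
    rewrite !normrM normr_sg phit0 mulr1 normrX ler_piMr//.
    by rewrite exprn_ile1.
  by rewrite ler_norml => /andP[].
(* The gain over [J], of length [delta], is e N K delta; this [N] makes it exceed the possible loss
   [I0]. *)
pose N := (Num.truncn (I0 / (e * K * delta))).+1.
have NI0 : I0 < e * (N%:R * K) * delta.
  have eKd : 0 < e * K * delta by apply: mulr_gt0 => //; exact: mulr_gt0.
  rewrite (_ : _ * delta = N%:R * (e * K * delta)); last by ring.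
  by rewrite -ltr_pdivrMr// truncnS_gt.
have cN : continuous (fun t => (sg *: p ^+ N).[t]) by exact: continuous_horner.
have intL : mu.-integrable setT (EFin \o (fun t => e * (N%:R * K) * \1_J t)).
  exact: (integrableZl measurableT _ intJ).
have : \int[mu]_t (e * (N%:R * K) * \1_J t - `|phi t|) <=
       \int[mu]_t (phi t * (sg *: p ^+ N).[t]).
  apply: le_Rintegral => //.
  - exact: (integrableB measurableT intL intI0).
  - exact: integrable_weighted.
(* The right-hand integral is a combination of moments, hence 0, whereas the left-hand one is e N K
   delta - I0 > 0. *)
rewrite -[_ *: _]coefK Rintegral_weighted_poly big1 => [|k _]; last first.
  by rewrite m0 mulr0.
by rewrite RintegralB// RintegralZl// muJ -/I0; lra.
Qed.

Lemma exists_laplace_neq0 : (exists t, phi t != 0) ->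
  exists x, [/\ x != 0, \int[mu]_t (phi t * expR (x * t)) != 0 &
                 \int[mu]_t (phi t * expR (- x * t)) != 0].
Proof.
move=> [t1 phit1].
have ex_moment : exists n, moment n != 0.
  apply: contrapT => noex; move: phit1; rewrite moments_eq0 ?eqxx// => n.
  by apply/eqP/negPn/negP => mn; apply: noex; exists n.
have [n mn minn] := ex_minnP ex_moment.
(* [C] is the constant of the O(x^{n+1}) term, uniform for |x| <= 1 because then e^{|xt|} <=
   e^{|t|}. *)
pose C := \int[mu]_t (`|phi t| * (`|t| ^+ n.+1 * expR `|t|)).
have cexpR (x : R) : continuous (fun t => expR (x * t)).
  move=> t; apply: continuous_comp; last exact: continuous_expR.
  by apply: cvgM; [exact: cvg_cst|exact: cvg_id].
have intC : mu.-integrable setT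
    (EFin \o (fun t => `|phi t| * (`|t| ^+ n.+1 * expR `|t|))).
  apply: integrable_normr_weighted => t.
  have nt : {for t, continuous (fun t : R => `|t|)} by exact: norm_continuous.
  apply: cvgM.
    by apply: (continuous_comp (g := @GRing.exp R ^~ n.+1) nt);
      exact: exprn_continuous.
  by apply: (continuous_comp (g := expR) nt); exact: continuous_expR.
pose taylor x : {poly R} := \poly_(k < n.+1) (x ^+ k / k`!%:R).
have taylorE (x t : R) : (taylor x).[t] = \sum_(k < n.+1) (x * t) ^+ k / k`!%:R.
  rewrite horner_poly; apply: eq_bigr => k _.
  by rewrite exprMn mulrAC.
(* By minimality of [n] all lower moments vanish, so only the top Taylor term survives. *)
have int_taylor (x : R) : \int[mu]_t (phi t * (taylor x).[t]) =
    x ^+ n / n`!%:R * moment n.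
  rewrite Rintegral_weighted_poly big_ord_recr/= big1 ?add0r// => k _.
  apply/eqP; rewrite mulf_eq0; apply/orP; right; apply: contraT => mk.
  by have := minn _ mk; rewrite leqNgt ltn_ord.
have asymp (x : R) : `|x| <= 1 ->
    `|\int[mu]_t (phi t * expR (x * t)) - x ^+ n / n`!%:R * moment n| <=
    `|x| ^+ n.+1 * C.
  move=> x1; rewrite -int_taylor.
  have cT : continuous (horner (taylor x)) by exact: continuous_horner.
  have cD : continuous (fun t => expR (x * t) - (taylor x).[t]).
    by move=> t; apply: cvgB; [exact: cexpR|exact: cT].
  rewrite -RintegralB//; [|exact: integrable_weighted..].
  under eq_Rintegral do rewrite -mulrBr.
  apply: le_trans (le_normr_Rintegral _ _) _ => //.
    exact: integrable_weighted.
  rewrite -RintegralZl//; apply: le_Rintegral => //.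
  - under [X in EFin \o X]eq_fun do rewrite normrM.
    apply: integrable_normr_weighted => t.
    by apply: (continuous_comp (g := fun s : R => `|s|) (cD t));
      exact: norm_continuous.
  - exact: (integrableZl measurableT _ intC).
  move=> t _; rewrite normrM taylorE mulrCA ler_wpM2l//.
  apply: le_trans (expR_taylor_le _ _ _) _.
  rewrite normrM exprMn -mulrA ler_wpM2l ?exprn_ge0//.
  rewrite ler_wpM2l ?exprn_ge0// ler_expR.
  by rewrite ler_piMl.
have C0 : 0 <= C.
  by apply: Rintegral_ge0 => t _; rewrite !mulr_ge0 ?exprn_ge0 ?expR_ge0.
pose m := `|moment n| / n`!%:R.
have m0 : 0 < m by rewrite divr_gt0 ?normr_gt0// ltr0n fact_gt0.
(* The bound 1 makes [asymp] applicable; the other gives x (C + 1) <= m, hence x C < m, so the error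
   is smaller than the leading term m x^n. *)
pose x := Num.min 1 (m / (C + 1)).
have x0 : 0 < x by rewrite lt_min ltr01 divr_gt0// ltr_wpDl.
(* The estimate depends on |y| only, which covers [x] and [- x] at once. *)
have nz y : `|y| = x -> \int[mu]_t (phi t * expR (y * t)) != 0.
  move=> yx; apply/negP => /eqP Phi0.
  have := asymp y; rewrite yx ge_min lexx Phi0 => /(_ isT).
  rewrite sub0r normrN !normrM normrX normfV yx [`|n`!%:R|]ger0_norm//.
  rewrite -mulrA [_^-1 * _]mulrC -/m exprSr -mulrA ler_pM2l ?exprn_gt0//.
  apply/negP; rewrite -ltNge.
  have : x * (C + 1) <= m.
    by rewrite -ler_pdivlMr ?ge_min ?lexx ?orbT// ltr_wpDl.
  by rewrite mulrDr mulr1; apply: lt_le_trans; rewrite ltrDl.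
exists x; split; first exact: lt0r_neq0.
  by apply: nz; rewrite gtr0_norm.
by apply: nz; rewrite normrN gtr0_norm.
Qed.
End CompactlySupportedWeight.

(** * Nonzero minors of matrices of full column rank *)

(** [fullrankfun] selects N independent rows in an unspecified order. Listing the same rows
    increasingly keeps their span, so the square submatrix stays invertible. *)
Lemma exists_increasing_minor (F : fieldType) (m N : nat) (A : 'M[F]_(m, N)) :
  row_full A -> exists2 r : 'I_N -> 'I_m,
    {homo r : i j / (i < j)%N} & \det (rowsub r A) != 0.
Proof.
move=> fA; pose f := fullrankfun fA; pose S : {set 'I_m} := [set f i | i : 'I_N].
have cardS : #|S| = N by rewrite card_imset ?card_ord//; exact: fullrankfun_inj.
pose r (i : 'I_N) : 'I_m := enum_val (cast_ord (esym cardS) i).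
have lt_trans_ord : transitive (fun i j : 'I_m => (i < j)%N).
  by move=> j i k; exact: ltn_trans.
have sorted_enumS : sorted (fun i j : 'I_m => (i < j)%N) (enum S).
  rewrite {1}/enum_mem; apply: sorted_filter => //; rewrite -enumT.
  by have := iota_ltn_sorted 0 m; rewrite -val_enum_ord sorted_map.
exists r => [i j ij|].
  rewrite /r !(enum_val_nth (f i)).
  by apply: (sorted_ltn_nth lt_trans_ord (f i) sorted_enumS) => //;
    rewrite inE/= -cardE cardS.
rewrite -unitfE -unitmxE -row_full_unit -sub1mx.
apply: submx_trans (_ : (rowsub f A <= _)%MS).
  by rewrite sub1mx; exact: fullrowsub_full.
apply/row_subP => i; have fiS : f i \in S by exact: imset_f.
pose j := cast_ord cardS (enum_rank_in fiS (f i)).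
have rj : r j = f i by rewrite /r cast_ordK enum_rankK_in.
rewrite (_ : row i _ = row j (rowsub r A)) ?row_sub//.
by apply/rowP => k; rewrite !mxE rj.
Qed.

(** If B is a left inverse of A, the rows of B indexed by [s] form a left inverse of the selected
    columns, [s] being injective. *)
Lemma row_full_colsub (F : fieldType) (m n N : nat) (A : 'M[F]_(m, n))
    (s : 'I_N -> 'I_n) : injective s -> row_full A -> row_full (colsub s A).
Proof.
move=> inj_s /row_fullP[B BA]; apply/row_fullP; exists (rowsub s B).
rewrite -mxsub_mul BA; apply/matrixP => i j.
by rewrite !mxE (inj_eq inj_s).
Qed.

(** * Smoothness, supports and integrals of translates *)

Lemma continuous_smooth (R : realType) (f : R -> R) : smooth f -> continuous f.
Proof.
by move=> sf t; apply/differentiable_continuous/derivable1_diffP; exact: (sf 0%N).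
Qed.

Lemma notin_supp (R : realType) (f : R -> R) (t : R) : ~ supp f t -> f t = 0.
Proof.
by move=> ft; apply/eqP/negPn/negP => ft0; apply: ft; exact: subset_closure.
Qed.

Lemma smooth_shift (R : realType) (f : R -> R) (d : R) :
  smooth f -> smooth (fun t => f (t - d)).
Proof.
move=> sf; have dsf n (t : R) : is_derive t 1 (fun t => derive1n n f (t - d))
    (derive1n n.+1 f (t - d)).
  have dshift : is_derive t 1 (fun t : R => t - d) 1 by exact: is_derive_shift.
  have df : is_derive (t - d) 1 (derive1n n f) (derive1n n.+1 f (t - d)).
    by apply: DeriveDef; [exact: sf|rewrite derive1nS derive1E].
  rewrite -[derive1n n.+1 _ _]mulr1.
  exact: (is_derive1_comp (f := derive1n n f)).
suff nE n : derive1n n (fun t => f (t - d)) = (fun t => derive1n n f (t - d)).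
  by move=> n t; rewrite nE; have [] := dsf n t.
elim: n => [//|n IH]; rewrite derive1nS IH; apply/funext => t.
by rewrite derive1E; have [] := dsf n t.
Qed.

Lemma Cc_smooth_shift (R : realType) (I : set R) (f : R -> R) (d : R) :
  smooth f -> compactly_contained [set t + d | t in supp f] I ->
  Cc_smooth I (fun t => f (t - d)).
Proof.
move=> sf [cpt sub].
have supp_sub : supp (fun t => f (t - d)) `<=` closure [set t + d | t in supp f].
  apply: closureS => t /= ft; exists (t - d); last exact: subrK.
  exact: subset_closure.
split; first exact: smooth_shift.
  apply: subclosed_compact cpt supp_sub; exact: closed_closure.
exact: subset_trans sub.
Qed.

Lemma Rintegral_itv_shift_weight (R : realType) (a b d : R) (phi g : R -> R) :
  continuous phi -> continuous g -> phi <> (fun=> 0) ->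
  supp (fun t => phi (t - d)) `<=` `]a, b[ ->
  \int[lebesgue_measure]_(t in `]a, b[) (phi (t - d) * g t) =
  \int[lebesgue_measure]_t (phi t * g (t + d)).
Proof.
move=> cphi cg phi0 supp_ab.
have [t0 phit0] : exists t, phi t != 0.
  apply: contrapT => no; apply: phi0; apply/funext => t.
  by apply/eqP/negPn/negP => ft; apply: no; exists t.
(* A point where [phi] is nonzero, translated by [d], lies in the interval and so orders its
   endpoints. *)
have ab : a <= b.
  have : `]a, b[%classic (t0 + d).
    by apply/supp_ab/subset_closure; rewrite /= addrK.
  by rewrite /= in_itv/= => /andP[/lt_trans ab /ab /ltW].
rewrite (Rintegral_shift _ _ _ d)//.
- by apply: eq_Rintegral => t _; rewrite addrK.
- move=> t; apply: cvgM; last exact: cg.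
  apply: (continuous_comp (f := fun t => t - d) (g := phi)); last exact: cphi.
  by apply: cvgB; [exact: cvg_id|exact: cvg_cst].
- by move=> t tab; rewrite (notin_supp _ (fun t => phi (t - d))) ?mul0r// => /supp_ab.
Qed.

Local Open Scope complex_scope.

(** * Laplace transforms at real points *)

Lemma cexp_real (R : realType) (x : R) : cexp x%:C = (expR x)%:C.
Proof. by rewrite /cexp/= cos0 sin0 mulr1. Qed.

Lemma cintegral_real (R : realType) (I : set R) (f : R -> R) :
  cintegral I (fun t => (f t)%:C) = (\int[lebesgue_measure]_(t in I) f t)%:C.
Proof.
rewrite /cintegral; congr (_ +i* _); under eq_Rintegral do rewrite /=.
by rewrite /Rintegral integral0.
Qed.

Lemma laplace_real (R : realType) (I : set R) (psi : R -> R) (x : R) :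
  laplace I psi x%:C =
  (\int[lebesgue_measure]_(t in I) (psi t * expR (x * t)))%:C.
Proof.
rewrite -cintegral_real; congr cintegral; apply/funext => t.
by rewrite -rmorphM cexp_real -rmorphM.
Qed.

Lemma laplace'_real (R : realType) (I : set R) (psi : R -> R) (x : R) :
  laplace' I psi x%:C =
  (\int[lebesgue_measure]_(t in I) (psi t * (t * expR (x * t))))%:C.
Proof.
rewrite -cintegral_real; congr cintegral; apply/funext => t.
by rewrite -rmorphM cexp_real -rmorphM mulrA [psi t * t]mulrC.
Qed.

(** * Minors of the matrices of translated profiles *)

Section TranslatedProfiles.
Context (R : realType) (a b : R) (phi : R -> R).
Context (phi_Cc : Cc_smooth [set: R] phi) (phi_neq0 : phi <> (fun=> 0)).

Local Notation I := (`]a, b[%classic : set R).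
Local Notation Phi x := (\int[lebesgue_measure]_t (phi t * expR (x * t))).
Local Notation Phi' x := (\int[lebesgue_measure]_t (phi t * (t * expR (x * t)))).

Let cphi : continuous phi.
Proof. by apply: continuous_smooth; case: phi_Cc. Qed.

Lemma bounded_support_Cc : exists A, forall t, A < `|t| -> phi t = 0.
Proof.
have [_ /compact_bounded[M [_ HM]] _] := phi_Cc.
(* [HM] bounds the support by every real strictly above [M], whence M + 1. *)
exists (M + 1) => t tM; apply: notin_supp => /(HM (M + 1)).
by rewrite ltrDl ltr01 => /(_ isT); rewrite /= leNgt tM.
Qed.

Let continuous_exp_lin (x : R) : continuous (fun t : R => expR (x * t)).
Proof.
move=> t; apply: continuous_comp; last exact: continuous_expR.
by apply: cvgM; [exact: cvg_cst|exact: cvg_id].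
Qed.

Lemma laplace_translate (d x : R) : supp (fun t => phi (t - d)) `<=` I ->
  laplace I (fun t => phi (t - d)) x%:C = (expR (x * d) * Phi x)%:C.
Proof.
move=> suppI; have [A phi0] := bounded_support_Cc.
rewrite laplace_real Rintegral_itv_shift_weight//.
rewrite -(Rintegral_weightedZ _ _ A)//.
by congr _%:C; apply: eq_Rintegral => t _;
  rewrite mulrDr expRD [expR (x * d) * _]mulrC.
Qed.

Lemma laplace'_translate (d x : R) : supp (fun t => phi (t - d)) `<=` I ->
  laplace' I (fun t => phi (t - d)) x%:C =
  (expR (x * d) * (Phi' x + d * Phi x))%:C.
Proof.
move=> suppI; have [A phi0] := bounded_support_Cc.
have ct : continuous (fun t : R => t * expR (x * t)).
  by move=> t; apply: cvgM; [exact: cvg_id|exact: continuous_exp_lin].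
have cd : continuous (fun t : R => d * expR (x * t)).
  by move=> t; apply: cvgM; [exact: cvg_cst|exact: continuous_exp_lin].
rewrite laplace'_real Rintegral_itv_shift_weight//.
rewrite -(Rintegral_weightedZ _ _ A)// -(Rintegral_weightedD _ _ A)//.
rewrite -(Rintegral_weightedZ _ _ A)//; last first.
  by move=> t; apply: cvgD; [exact: ct|exact: cd].
congr _%:C; apply: eq_Rintegral => t _.
by rewrite [x * (t + d)]mulrDr expRD; ring.
Qed.

Section Family.
Context (d : 'I_4 -> R) (x : R).
Context (d_incr : {homo d : i j / (i < j)%N >-> (i < j)%R}).
Context (suppI : forall k, supp (fun t => phi (t - d k)) `<=` I).
Context (x_neq0 : x != 0) (Phi_neq0 : Phi x != 0).
Context (PhiN_neq0 : Phi (- x) != 0).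

Local Notation psi := (fun k t => phi (t - d k)).

Let d_inj : injective d.
Proof.
move=> i j dij; have [/d_incr|/d_incr|/val_inj//] := ltngtP i j.
  by rewrite dij ltxx.
by rewrite dij ltxx.
Qed.

Lemma det_hermite_neq0 : \det (hermite_matrix I psi x%:C) != 0.
Proof.
pose H : 'M[R]_4 := \matrix_(i, k)
  [:: expR (x * d k) * Phi x;
      expR (x * d k) * (Phi' x + d k * Phi x);
      expR (- x * d k) * Phi (- x);
      expR (- x * d k) * (Phi' (- x) + d k * Phi (- x))]`_i.
(* At a real point all entries are real, so invertibility can be tested over R, where Rolle's
   theorem is available. *)
have -> : hermite_matrix I psi x%:C = map_mx (real_complex R) H.
  apply/matrixP => i k; rewrite !mxE -rmorphN.
  by case: i => [[|[|[|[|//]]]]] ? /=;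
    rewrite ?laplace_translate ?laplace'_translate.
rewrite det_map_mx fmorph_eq0; apply/negP => /det0P[v v0 vH].
have vHk k :
    (v 0 0 * Phi x + v 0 1 * Phi' x + v 0 1 * Phi x * d k) * expR (x * d k) +
    (v 0 2 * Phi (- x) + v 0 3 * Phi' (- x) + v 0 3 * Phi (- x) * d k) *
      expR (- x * d k) = 0.
  have /matrixP/(_ 0 k) := vH; rewrite !mxE !big_ord_recl big_ord0 !mxE/=.
  rewrite (_ : lift ord0 ord0 = 1)//; last exact: val_inj.
  rewrite (_ : lift ord0 (lift ord0 ord0) = 2)//; last exact: val_inj.
  rewrite (_ : lift ord0 (lift ord0 (lift ord0 ord0)) = 3)//; last first.
    exact: val_inj.
  by move=> <-; ring.
have [] := exp_polynomial_eq0 _ _ _ _ _ _ _ x_neq0 d_incr vHk.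
(* The slopes give [v 0 1] = [v 0 3] = 0 first; this removes the [Phi'] terms from the constants,
   which then give [v 0 0] = [v 0 2] = 0. *)
move=> + /eqP + + /eqP; rewrite !mulf_eq0 (negbTE Phi_neq0) (negbTE PhiN_neq0).
rewrite !orbF => + /eqP v1 + /eqP v3; rewrite v1 v3 !mul0r !addr0.
move=> /eqP + /eqP; rewrite !mulf_eq0 (negbTE Phi_neq0) (negbTE PhiN_neq0).
rewrite !orbF => /eqP v00 /eqP v2; move/eqP: v0; apply; apply/rowP => i.
rewrite mxE; case: i => [[|[|[|[|//]]]]] ?.
- by rewrite -[RHS]v00; congr (v 0 _); exact: val_inj.
- by rewrite -[RHS]v1; congr (v 0 _); exact: val_inj.
- by rewrite -[RHS]v2; congr (v 0 _); exact: val_inj.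
- by rewrite -[RHS]v3; congr (v 0 _); exact: val_inj.
Qed.

Lemma hermite_minor (N : nat) (s : 'I_N -> 'I_4) : injective s ->
  some_minor_not_identically_zero (hermite_matrix I (fun k => psi (s k))).
Proof.
move=> s_inj; have /exists_increasing_minor[r r_incr detr] :
    row_full (colsub s (hermite_matrix I psi x%:C)).
  apply: row_full_colsub => //; rewrite row_full_unit unitmxE unitfE.
  exact: det_hermite_neq0.
exists r => //; exists x%:C; rewrite (_ : rowsub r _ = rowsub r
  (colsub s (hermite_matrix I psi x%:C)))//.
by apply/matrixP => i j; rewrite !mxE.
Qed.

(** One profile is settled by the row at z = x. For two profiles, a relation between the rows at x
    and -x, multiplied by e^{xt}, is affine in e^{2xt} and vanishes at two distinct values of it. *)
Lemma two_sided_minor (N : nat) (s : 'I_N -> 'I_4) : (1 <= N <= 2)%N ->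
  injective s ->
  some_minor_not_identically_zero (two_sided_matrix I (fun k => psi (s k))).
Proof.
case: N s => [//|[|[|//]]] s _ s_inj.
  exists (fun=> 0) => [i j|]; first by rewrite !ord1.
  exists x%:C; rewrite det_mx11 !mxE/= laplace_translate// fmorph_eq0.
  by rewrite mulf_neq0// gt_eqF// expR_gt0.
exists id => //; exists x%:C.
pose V : 'M[R]_2 := \matrix_(i, k)
  [:: expR (x * d (s k)) * Phi x; expR (- x * d (s k)) * Phi (- x)]`_i.
rewrite (_ : rowsub id _ = map_mx (real_complex R) V); last first.
  apply/matrixP => i k; rewrite !mxE -rmorphN.
  by case: i => [[|[|//]]] ? /=; rewrite laplace_translate.
rewrite det_map_mx fmorph_eq0; apply/negP => /det0P[v v0 vV].
have vVk k : v 0 1 * Phi (- x) + v 0 0 * Phi x * expR (2 * x * d (s k)) = 0.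
  have /matrixP/(_ 0 k) := vV; rewrite !mxE !big_ord_recl big_ord0 !mxE/=.
  rewrite (_ : lift ord0 ord0 = 1)//; last exact: val_inj.
  move=> /(congr1 (fun y => expR (x * d (s k)) * y)); rewrite mulr0 => <-.
  rewrite (_ : 2 * x * d (s k) = x * d (s k) + x * d (s k)); last by ring.
  rewrite expRD mulNr -[in LHS](mulr1 (v 0 1)) -(expRxMexpNx_1 (x * d (s k))).
  by ring.
have exp_neq : expR (2 * x * d (s 0)) != expR (2 * x * d (s 1)).
  rewrite (inj_eq (@expR_inj R)) (inj_eq (mulfI _)) ?mulf_neq0 ?pnatr_eq0//.
  by rewrite (inj_eq d_inj) (inj_eq s_inj).
have [] := affine_eq0 _ _ _ _ _ exp_neq (vVk 0) (vVk 1).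
move=> /eqP + /eqP; rewrite !mulf_eq0 (negbTE Phi_neq0) (negbTE PhiN_neq0) !orbF.
move=> /eqP v1 /eqP v00; move/eqP: v0; apply; apply/rowP => i.
rewrite mxE; case: i => [[|[|//]]] ?.
- by rewrite -[RHS]v00; congr (v 0 _); exact: val_inj.
- by rewrite -[RHS]v1; congr (v 0 _); exact: val_inj.
Qed.

End Family.
End TranslatedProfiles.

Local Close Scope complex_scope.

Theorem proposition2p6 (R : realType) (a b : R) (phi : R -> R) (d : 'I_4 -> R)
    (phi_Cc : Cc_smooth [set: R] phi)
    (phi_neq0 : phi <> (fun=> 0))
    (d_incr : {homo d : i j / (i < j)%N >-> (i < j)%R})
    (supp_in : forall k : 'I_4,
       compactly_contained [set t + d k | t in supp phi] `]a, b[%classic) :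
  let I : set R := `]a, b[%classic in
  let psi : 'I_4 -> R -> R := fun k t => phi (t - d k) in
  [/\ hermite_laplace_nondegenerate I psi,
      (forall (N : nat) (s : 'I_N -> 'I_4), (1 <= N <= 2)%N -> injective s ->
         two_sided_laplace_nondegenerate I (fun k => psi (s k)))
    & (forall (N : nat) (s : 'I_N -> 'I_4), (1 <= N <= 4)%N -> injective s ->
         hermite_laplace_nondegenerate I (fun k => psi (s k)))].
Proof.
move=> I psi; have sphi : smooth phi by case: phi_Cc.
have psi_Cc k : Cc_smooth I (psi k) by exact: Cc_smooth_shift.
have suppI k : supp (fun t => phi (t - d k)) `<=` I by have [] := psi_Cc k.
have [A phi0] := bounded_support_Cc _ _ phi_Cc.
have [x [x0 Phi0 PhiN0]] : exists x, [/\ x != 0,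
    \int[lebesgue_measure]_t (phi t * expR (x * t)) != 0 &
    \int[lebesgue_measure]_t (phi t * expR (- x * t)) != 0].
  apply: (exists_laplace_neq0 _ _ A) => //; first exact: continuous_smooth.
  apply: contrapT => no; apply: phi_neq0; apply/funext => t.
  by apply/eqP/negPn/negP => ft; apply: no; exists t.
(* One real point [x] serves all subfamilies; the full family is the case [s := id]. *)
have hermite N (s : 'I_N -> 'I_4) : (1 <= N <= 4)%N -> injective s ->
    hermite_laplace_nondegenerate I (fun k => psi (s k)).
  move=> N4 s_inj; split => //.
  exact: (hermite_minor _ _ _ _ phi_Cc phi_neq0 _ x).
split => //; first exact: (hermite 4 id).
move=> N s N2 s_inj; split => //.
exact: (two_sided_minor _ _ _ _ phi_Cc phi_neq0 _ x).
Qed.
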